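(* Let $G=\langle X;R\rangle$ be a finitely generated group. Then whether or not the associated word problem $\mathrm{WP}(G:X;R)$ is in $\mathcal{BDC}$ (respectively $\mathcal{PCF}$) is independent of the given presentation (with finite generating set) of $G$. Moreover, if the word problem of $G$ is in $\mathcal{BDC}$ (respectively $\mathcal{PCF}$), then every finitely generated subgroup of $G$ also has word problem in $\mathcal{BDC}$ (respectively $\mathcal{PCF}$).
   Context: For a group $G=\langle X;R\rangle$ with $X$ finite, let $\Sigma=X\cup X^{-1}$; the word problem of $G$ relative to this presentation is the language $\mathrm{WP}(G:X;R)=\{w\in\Sigma^*: w=1\text{ in }G\}$. $\mathcal{BDC}$ denotes the Boolean closure of the class of deterministic context-free languages: a language over a finite alphabet $\Sigma$ is in $\mathcal{BDC}$ if it belongs to the smallest family of subsets of $\Sigma^*$ containing the deterministic context-free languages over $\Sigma$ and closed under finite union, finite intersection and complement. $\mathcal{PCF}$ denotes the class of poly-context-free languages, i.e. intersections of finitely many context-free languages over the same alphabet. *)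

(* Defs.v *)
From HB Require Import structures.
From Stdlib Require Import Relation_Operators.
From mathcomp Require Import all_boot.
From mathcomp Require Import boolp classical_sets.

Set Implicit Arguments.
Unset Strict Implicit.
Unset Printing Implicit Defensive.

Local Open Scope classical_set_scope.

Definition language (A : finType) := set (seq A).

Definition language_class := forall A : finType, language A -> Prop.

(** * Context-free languages *)

Record cfg (A : finType) := Cfg {
  cfg_nt : finType;
  cfg_start : cfg_nt;
  cfg_rules : seq (cfg_nt * seq (cfg_nt + A))
}.

Inductive cfg_step (A : finType) (g : cfg A) :
    seq (cfg_nt g + A) -> seq (cfg_nt g + A) -> Prop :=
| CfgStep (u v : seq (cfg_nt g + A)) (N : cfg_nt g) (r : seq (cfg_nt g + A)) :
    (N, r) \in cfg_rules g -> cfg_step (u ++ inl N :: v) (u ++ r ++ v).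

Definition cfg_lang (A : finType) (g : cfg A) : language A :=
  [set w | clos_refl_trans _ (@cfg_step A g)
             [:: inl (cfg_start g)] [seq inr a | a <- w]].

Definition context_free : language_class :=
  fun A L => exists g : cfg A, L = cfg_lang g.

(** * Deterministic context-free languages *)

(* [dpda_trans q (Some a) Z] is the move reading the letter [a] in state [q]
   with [Z] on top of the stack, and [dpda_trans q None Z] the move that reads
   nothing; [Some (q', s)] means: go to [q'] and replace [Z] by [s], whose head
   becomes the top, while [None] means that there is no such move. *)
Record dpda (A : finType) := Dpda {
  dpda_state : finType;
  dpda_stack : finType;
  dpda_init : dpda_state;
  dpda_bottom : dpda_stack;
  dpda_final : pred dpda_state;
  dpda_trans : dpda_state -> option A -> dpda_stack ->
               option (dpda_state * seq dpda_stack);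
  dpda_det : forall q Z, dpda_trans q None Z <> None ->
               forall a, dpda_trans q (Some a) Z = None
}.

Definition dpda_config (A : finType) (M : dpda A) : Type :=
  (dpda_state M * seq A * seq (dpda_stack M))%type.

Inductive dpda_step (A : finType) (M : dpda A) :
    dpda_config M -> dpda_config M -> Prop :=
| DpdaRead q a w Z t q' s : dpda_trans q (Some a) Z = Some (q', s) ->
    dpda_step (q, a :: w, Z :: t) (q', w, s ++ t)
| DpdaEps q w Z t q' s : dpda_trans q None Z = Some (q', s) ->
    dpda_step (q, w, Z :: t) (q', w, s ++ t).

(* Acceptance is by final state: acceptance by empty stack would only give the
   prefix-free deterministic context-free languages. *)
Definition dpda_lang (A : finType) (M : dpda A) : language A :=
  [set w | exists q t, dpda_final q /\
     clos_refl_trans _ (@dpda_step A M)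
       (dpda_init M, w, [:: dpda_bottom M]) (q, [::], t)].

Definition det_context_free : language_class :=
  fun A L => exists M : dpda A, L = dpda_lang M.

(** * The classes BDC and PCF *)

Inductive BDC (A : finType) : language A -> Prop :=
| BDC_dcf L : det_context_free L -> BDC L
| BDC_union L1 L2 : BDC L1 -> BDC L2 -> BDC (L1 `|` L2)
| BDC_inter L1 L2 : BDC L1 -> BDC L2 -> BDC (L1 `&` L2)
| BDC_compl L : BDC L -> BDC (~` L).

Definition PCF : language_class :=
  fun A L => exists (k : nat) (F : nat -> language A),
    (forall i, (i < k)%N -> context_free (F i)) /\ L = \bigcap_(i < k) F i.

(** * Presentations and word problems *)

(* The alphabet consisting of X and its formal inverses: [(x, false)] stands
   for x and [(x, true)] for x^-1. *)
Definition letter (X : finType) : finType := (X * bool)%type.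

Section Words.
Local Open Scope group_scope.

Definition letter_val (G : groupType) (X : finType) (f : X -> G)
    (s : letter X) : G :=
  if s.2 then (f s.1)^-1 else f s.1.

Definition word_val (G : groupType) (X : finType) (f : X -> G)
    (w : seq (letter X)) : G :=
  \prod_(s <- w) letter_val f s.

Definition generates (G : groupType) (X : finType) (f : X -> G) : Prop :=
  forall g : G, exists w, word_val f w = g.

End Words.

Definition finitely_generated (G : groupType) : Prop :=
  exists (X : finType) (f : X -> G), generates f.

(* The congruence on words whose quotient monoid is the group <X; R>: it is
   generated by x x^-1 = x^-1 x = 1 for x in X and r = 1 for r in R. *)
Inductive pres_eq (X : finType) (R : set (seq (letter X))) :
    seq (letter X) -> seq (letter X) -> Prop :=
| PresRefl w : pres_eq R w w
| PresSym w1 w2 : pres_eq R w1 w2 -> pres_eq R w2 w1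
| PresTrans w1 w2 w3 : pres_eq R w1 w2 -> pres_eq R w2 w3 -> pres_eq R w1 w3
| PresFree u v x b : pres_eq R (u ++ (x, b) :: (x, ~~ b) :: v) (u ++ v)
| PresRel u v r : R r -> pres_eq R (u ++ r ++ v) (u ++ v).

(* A presentation of G with a finite generating set and an arbitrary set of
   relators.  The last two fields say that [pres_val] induces an isomorphism
   from <X; R> onto G. *)
Record presentation (G : groupType) := Presentation {
  pres_gen : finType;
  pres_rel : set (seq (letter pres_gen));
  pres_val : pres_gen -> G;
  pres_surj : generates pres_val;
  pres_inj : forall w1 w2, word_val pres_val w1 = word_val pres_val w2 <->
                           pres_eq pres_rel w1 w2
}.

Definition word_problem (G : groupType) (P : presentation G) :
    language (letter (pres_gen P)) :=
  [set w | word_val (@pres_val G P) w = 1%g].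
Arguments word_problem {G} P _.

(* "The word problem of G is in C", relative to some presentation with finite
   generating set. *)
Definition has_word_problem_in (C : language_class) (G : groupType) : Prop :=
  exists P : presentation G, C _ (word_problem P).

(* Main.v *)
(** An injective group morphism, lifted to words by substituting for each
    generator a word representing its image, has one word problem as the
    inverse image of the other.  So all that
    matters is that BDC and PCF are closed under inverse homomorphisms [h] of
    free monoids.  Inverse images commute with Boolean operations, hence it
    suffices to treat deterministic context-free and context-free languages.
    Both are handled with a buffer holding the part of [h b] that is not yet
    consumed: for automata the buffer is a component of the state, and for
    grammars a nonterminal is annotated with the contents of the buffer before
    and after the word that it derives. *)

Require Import Defs.
From mathcomp Require Import all_boot.
From Stdlib Require Import Relation_Operators Operators_Properties.
From mathcomp Require Import boolp classical_sets.

Set Implicit Arguments.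
Unset Strict Implicit.
Unset Printing Implicit Defensive.

(** * Homomorphisms of free monoids and inverse images *)

Definition hom (B : Type) (A : Type) (h : B -> seq A) (w : seq B) : seq A :=
  flatten [seq h b | b <- w].

Lemma hom_cat (B A : Type) (h : B -> seq A) v w :
  hom h (v ++ w) = hom h v ++ hom h w.
Proof. by rewrite /hom map_cat flatten_cat. Qed.

Lemma hom_cons (B A : Type) (h : B -> seq A) b w :
  hom h (b :: w) = h b ++ hom h w.
Proof. by []. Qed.

Definition inverse_hom_closed (C : language_class) : Prop :=
  forall (A B : finType) (h : B -> seq A) (L : language A),
    C A L -> C B (hom h @^-1` L)%classic.

(** * Context-free languages *)

Section Grammar.
Variable A : finType.

Section Sentential.
Variables (N : finType) (M : N -> seq A -> Prop).

Definition symbol_lang (x : N + A) (w : seq A) : Prop :=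
  match x with inl n => M n w | inr a => w = [:: a] end.

Fixpoint form_lang (s : seq (N + A)) (w : seq A) : Prop :=
  if s is x :: s' then
    exists w1 w2, [/\ w = w1 ++ w2, symbol_lang x w1 & form_lang s' w2]
  else w = [::].

Lemma form_lang_cat s t w :
  form_lang (s ++ t) w <->
  exists w1 w2, [/\ w = w1 ++ w2, form_lang s w1 & form_lang t w2].
Proof.
elim: s w => [|x s IHs] w /=.
  split=> [Ht|[w1 [w2 [-> -> //]]]].
  by exists [::], w.
split=> [[w1 [w2 [-> Hx /IHs[w3 [w4 [-> Hs Ht]]]]]]|].
  exists (w1 ++ w3), w4; split=> //; first by rewrite catA.
  by exists w1, w3.
move=> [w1 [w2 [-> [w3 [w4 [-> Hx Hs]]] Ht]]].
exists w3, (w4 ++ w2); split=> //; first by rewrite catA.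
by apply/IHs; exists w4, w2.
Qed.

Lemma form_lang_word w : form_lang [seq inr a | a <- w] w.
Proof. by elim: w => //= a w IHw; exists [:: a], w. Qed.

End Sentential.

Variable g : cfg A.

Local Notation derives := (clos_refl_trans _ (@cfg_step A g)).

(* The languages derived from the nonterminals form the least family closed
   under the rules. *)
Lemma derives_ind (M : cfg_nt g -> seq A -> Prop) :
  (forall n r w, (n, r) \in cfg_rules g -> form_lang M r w -> M n w) ->
  forall n w, derives [:: inl n] [seq inr a | a <- w] -> M n w.
Proof.
move=> HM n w Hd.
suff : form_lang M [:: inl n] w.
  by case=> w1 [w2 [-> /= Hn ->]]; rewrite cats0.
(* Membership in [form_lang M] is carried backwards along the derivation, starting from the terminal
   word, which belongs to its own language. *)
have := form_lang_word M w; elim: Hd => {n} [s t Hst|//|s t u _ IH1 _ IH2 Hw].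
  case: Hst => {s t} u v n r Hr /form_lang_cat [w1 [w2 [-> Hu]]].
  move/form_lang_cat=> [w3 [w4 [-> /(HM _ _ _ Hr) Hn Hv]]].
  by apply/form_lang_cat; exists w1, (w3 ++ w4); split=> //; exists w3, w4.
exact/IH1/IH2.
Qed.

Lemma derives_ctx u v s t : derives s t -> derives (u ++ s ++ v) (u ++ t ++ v).
Proof.
elim=> {s t} [_ _ [u' v' n r Hr]|s|s t t' _ IH1 _ IH2].
- by have := CfgStep (u ++ u') (v' ++ v) Hr; rewrite -!catA; apply: rt_step.
- exact: rt_refl.
- exact: rt_trans IH1 IH2.
Qed.

Lemma derives_cat s1 t1 s2 t2 :
  derives s1 t1 -> derives s2 t2 -> derives (s1 ++ s2) (t1 ++ t2).
Proof.
move=> H1 H2; apply: (@rt_trans _ _ _ (t1 ++ s2)).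
  exact: (derives_ctx [::] s2 H1).
by have := derives_ctx t1 [::] H2; rewrite !cats0.
Qed.

Lemma derives_rule n r t :
  (n, r) \in cfg_rules g -> derives r t -> derives [:: inl n] t.
Proof.
move=> Hr; apply: rt_trans; apply: rt_step.
by have := @CfgStep _ g [::] [::] _ _ Hr; rewrite cats0.
Qed.

End Grammar.

Section RulesOf.
Variables (N A : finType) (K : nat) (P : N -> seq (N + A) -> Prop).

(** A grammar needs a finite list of rules: bounding the right-hand sides by [K] makes the
    candidates range over a finite type, which is then filtered by [P]. *)
Definition rules_of : seq (N * seq (N + A)) :=
  [seq (x.1, val x.2) |
     x <- enum [pred x : N * K.-bseq (N + A) | `[< P x.1 x.2 >]]].

Lemma mem_rules_of n r :
  (forall n r, P n r -> size r <= K) -> (n, r) \in rules_of <-> P n r.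
Proof.
move=> HK; split.
  by case/mapP=> -[n' r']; rewrite mem_enum inE /= => Pr [-> ->].
move=> Pr; apply/mapP; exists (n, Bseq (HK _ _ Pr)) => //.
by rewrite mem_enum inE.
Qed.

End RulesOf.

(** * A grammar for the inverse image *)

Section InverseHomCfg.
Variables (A B : finType) (h : B -> seq A) (g : cfg A).

(** Leftovers between symbols stay shorter than [m]; the spare place is for the letter that
    [IhConsume] removes. *)
Let m := (\max_b size (h b)).+1.

Let size_h b : size (h b) < m.
Proof. by rewrite ltnS (leq_bigmax (F := fun b => size (h b))). Qed.

Let buffer : finType := m.-bseq A.

(* The nonterminal [(p, x, q)] derives the words [v] such that, starting from
   the buffer [p], appending [hom h v] and consuming a word derived from [x]
   leaves [q]; [None] stands for the empty sentential form. *)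
Definition ih_nt : finType := (buffer * option (cfg_nt g + A) * buffer)%type.

(** Intermediate buffers are guessed between the symbols of a right-hand side; the closing
    nonterminal absorbs the letters that remain after the last symbol. *)
Fixpoint ih_chain (p : buffer) (r : seq (cfg_nt g + A)) (q : buffer)
    (r' : seq (ih_nt + B)) : Prop :=
  if r is x :: r1 then
    exists p1 r1', r' = inl (p, Some x, p1) :: r1' /\ ih_chain p1 r1 q r1'
  else r' = [:: inl (p, None, q)].

Inductive ih_rule : ih_nt -> seq (ih_nt + B) -> Prop :=
| IhRead p x q b p' : val p' = val p ++ h b ->
    ih_rule (p, x, q) [:: inr b; inl (p', x, q)]
| IhDone p : ih_rule (p, None, p) [::]
| IhConsume p a q : val p = a :: val q -> ih_rule (p, Some (inr a), q) [::]
| IhExpand p n q r r' : (n, r) \in cfg_rules g -> ih_chain p r q r' ->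
    ih_rule (p, Some (inl n), q) r'.

(** Accounts for the closing nonterminal of a chain, and for the two symbols of [IhRead] even when
    every right-hand side of [g] is empty. *)
Let K := (\max_(x <- cfg_rules g) size x.2).+2.

Lemma size_ih_chain p r q r' : ih_chain p r q r' -> size r' = (size r).+1.
Proof.
elim: r p r' => [|x r IHr] p r' /=; first by move->.
by case=> p1 [r1 [-> /IHr /= ->]].
Qed.

Lemma size_ih_rule n r : ih_rule n r -> size r <= K.
Proof.
case=> // p {}n q {}r r' Hr /size_ih_chain ->; rewrite ltnS leqW //.
exact: (@leq_bigmax_seq _ _ xpredT
  (fun x : cfg_nt g * seq (cfg_nt g + A) => size x.2) _ Hr isT).
Qed.

Definition ih_cfg : cfg B :=
  @Cfg B ih_nt ([bseq], Some (inl (cfg_start g)), [bseq])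
    (rules_of K ih_rule).

Lemma ih_rulesP n r : (n, r) \in cfg_rules ih_cfg <-> ih_rule n r.
Proof. exact: mem_rules_of size_ih_rule. Qed.

Local Notation derives := (clos_refl_trans _ (@cfg_step A g)).
Local Notation ih_derives := (clos_refl_trans _ (@cfg_step B ih_cfg)).

Definition ih_lang (n : ih_nt) (v : seq B) : Prop :=
  exists w, derives (if n.1.2 is Some x then [:: x] else [::])
                    [seq inr a | a <- w] /\
            val n.1.1 ++ hom h v = w ++ val n.2.

(** The buffer equations telescope: the leftover of one symbol is the starting buffer of the
    next. *)
Lemma ih_chain_sound p r q r' v :
  ih_chain p r q r' -> form_lang ih_lang r' v ->
  exists w, derives r [seq inr a | a <- w] /\ val p ++ hom h v = w ++ val q.
Proof.
elim: r p r' v => [|x r IHr] p r' v /=.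
  by move=> -> [v1 [v2 [-> [w [/= Hw E]] ->]]]; exists w; rewrite cats0.
move=> [p1 [r1 [-> Hc]]] /= [v1 [v2 [-> [w1 [/= Hw1 E1]]]]].
move/(IHr _ _ _ Hc)=> [w2 [Hw2 E2]]; exists (w1 ++ w2); split.
  by rewrite map_cat; apply: derives_cat Hw1 Hw2.
by rewrite hom_cat catA E1 -!catA E2.
Qed.

Lemma ih_derives_sound n v :
  ih_derives [:: inl n] [seq inr b | b <- v] -> ih_lang n v.
Proof.
move: n v; apply: derives_ind => n r v /ih_rulesP Hr.
case: Hr v => {n r}.
- move=> p x q b p' E v /= [_ [_ [-> -> [v1 [v2 [-> [w [/= Hw Ew]] ->]]]]]].
  exists w; split=> //=; rewrite cats0 hom_cons -Ew E.
  by rewrite catA.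
- by move=> p _ ->; exists [::]; split; [apply: rt_refl | rewrite /= cats0].
- move=> p a q E _ ->; exists [:: a]; split; first exact: rt_refl.
  by rewrite /= cats0.
- move=> p n q r r' Hr Hc v /(ih_chain_sound Hc) [w [Hw Ew]].
  by exists w; split=> //; apply: derives_rule Hr Hw.
Qed.

(** All of [v] is read into the buffer first; every intermediate buffer is a prefix of [s], hence
    fits. *)
Lemma ih_derives_eat (s p q : buffer) x v :
  val p ++ hom h v = val s -> ih_derives [:: inl (s, x, q)] [::] ->
  ih_derives [:: inl (p, x, q)] [seq inr b | b <- v].
Proof.
move=> E Hs; elim: v p E => [|b v IHv] p.
  by rewrite cats0 => /val_inj ->.
rewrite hom_cons catA => E.
have Hp : size (val p ++ h b) <= m.
  by apply: leq_trans (size_bseq s); rewrite -E [leqRHS]size_cat leq_addr.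
apply: (@derives_rule _ ih_cfg _ [:: inr b; inl (Bseq Hp, x, q)]).
  exact/ih_rulesP/IhRead.
exact: (@derives_cat _ ih_cfg [:: inr b] [:: inr b]) (rt_refl _ _ _)
  (IHv (Bseq Hp) E).
Qed.

(* The split is made at the first prefix [v1] that covers [w1], which keeps the
   leftover [q] short. *)
Lemma hom_split p v w1 w2 :
  size p < m -> p ++ hom h v = w1 ++ w2 ->
  exists q v1 v2, [/\ v = v1 ++ v2, size q < m,
                      p ++ hom h v1 = w1 ++ q & q ++ hom h v2 = w2].
Proof.
elim: v p w1 => [|b v IHv] p w1 Hp E.
  exists w2, [::], [::]; split=> //; last by rewrite cats0.
  by apply: leq_ltn_trans Hp; rewrite -[p]cats0 [_ ++ _]E size_cat leq_addl.
have [le|lt] := leqP (size w1) (size p).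
  have Ep : p = w1 ++ drop (size w1) p.
    have := congr1 (take (size w1)) E.
    rewrite takel_cat // take_size_cat // => Ew.
    by rewrite -[X in X ++ _]Ew cat_take_drop.
  exists (drop (size w1) p), [::], (b :: v); split=> //.
  - by rewrite size_drop (leq_ltn_trans (leq_subr _ _) Hp).
  - by rewrite cats0.
  - by move/eqP: E; rewrite {1}Ep -catA eqseq_cat // eqxx => /eqP.
(* Now [w1] uses up all of [p], and the rest is split with [h b] as the new buffer, again shorter
   than [m]. *)
have Ep : w1 = p ++ drop (size p) w1.
  have := congr1 (take (size p)) E.
  rewrite take_size_cat // takel_cat ?(ltnW lt) // => {1}->.
  by rewrite cat_take_drop.
move: E; rewrite Ep -catA hom_cons.
move=> /eqP; rewrite eqseq_cat // eqxx /= => /eqP.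
move/(IHv _ _ (size_h b)) => [q [v1 [v2 [-> Hq E1 E2]]]].
exists q, (b :: v1), v2; split=> //.
by rewrite hom_cons E1 catA.
Qed.

(** The family to which [derives_ind] is applied for completeness; its strict size bounds are those
    that [hom_split] preserves. *)
Definition ih_complete (n : cfg_nt g) (w : seq A) : Prop :=
  forall (p q : buffer) v, size p < m -> size q < m ->
    val p ++ hom h v = w ++ val q ->
    ih_derives [:: inl (p, Some (inl n), q)] [seq inr b | b <- v].

(** All of [v] is read before [a] is consumed; the buffer [a :: val q] fits because [q] is strictly
    shorter than [m]. *)
Lemma ih_derives_letter (p q : buffer) a v :
  size q < m -> val p ++ hom h v = a :: val q ->
  ih_derives [:: inl (p, Some (inr a), q)] [seq inr b | b <- v].
Proof.
move=> Hq E; apply: (@ih_derives_eat (@Bseq m _ (a :: val q) Hq)) => //.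
apply: (@derives_rule _ ih_cfg _ [::]); last exact: rt_refl.
exact/ih_rulesP/IhConsume.
Qed.

Lemma ih_chain_complete r w (p q : buffer) v :
  form_lang ih_complete r w -> size p < m -> size q < m ->
  val p ++ hom h v = w ++ val q ->
  exists r', ih_chain p r q r' /\ ih_derives r' [seq inr b | b <- v].
Proof.
elim: r w p v => [|x r IHr] w p v /=.
  move=> -> _ _ E; exists [:: inl (p, None, q)]; split=> //.
  apply: (ih_derives_eat E); apply: (@derives_rule _ ih_cfg _ [::]).
    exact/ih_rulesP/IhDone.
  exact: rt_refl.
move=> [w1 [w2 [-> Hx Hr]]] Hp Hq; rewrite -catA.
(* The word [v] is cut where [w1] is covered; the leftover [q1] is the buffer handed to the
   remaining symbols. *)
move/(hom_split Hp) => [q1 [v1 [v2 [-> Hq1 E1 E2]]]].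
have [r1 [Hc Hd]] := IHr _ (Bseq (ltnW Hq1)) _ Hr Hq1 Hq E2.
exists (inl (p, Some x, Bseq (ltnW Hq1)) :: r1); split.
  by exists (Bseq (ltnW Hq1)), r1.
rewrite map_cat -cat1s; apply: derives_cat Hd.
case: x Hx => [n Hn|a Ea]; first exact: Hn.
by apply: ih_derives_letter; rewrite // E1 Ea.
Qed.

Lemma ih_derives_complete n w :
  derives [:: inl n] [seq inr a | a <- w] -> ih_complete n w.
Proof.
move: n w; apply: derives_ind => n r w Hr Hw p q v Hp Hq E.
have [r' [Hc Hd]] := ih_chain_complete Hw Hp Hq E.
apply: (@derives_rule _ ih_cfg _ r') Hd.
exact/ih_rulesP/(IhExpand Hr).
Qed.

Lemma ih_cfgP : cfg_lang ih_cfg = (hom h @^-1` cfg_lang g)%classic.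
Proof.
apply/seteqP; split=> v /=.
  move/ih_derives_sound=> [w [/= Hw E]].
  by move: E Hw; rewrite cats0 => ->.
by move/ih_derives_complete; apply; rewrite // cats0.
Qed.

End InverseHomCfg.

Lemma context_free_inverse_hom : inverse_hom_closed context_free.
Proof. by move=> A B h _ [g ->]; exists (ih_cfg h g); rewrite ih_cfgP. Qed.

Lemma PCF_inverse_hom : inverse_hom_closed PCF.
Proof.
move=> A B h _ [k [F [HF ->]]]; exists k, (fun i => hom h @^-1` F i)%classic.
by split=> // i /HF; apply: context_free_inverse_hom.
Qed.

(** * Deterministic context-free languages *)

Section InverseHomDpda.
Variables (A B : finType) (h : B -> seq A) (M : dpda A).

Let m := \max_b size (h b).
Let buffer : finType := m.-bseq A.

(* A state [Some (q, p)] stands for the state [q] with the letters [p] still to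
   be fed to [M]; [None] is the initial state.  The stack symbol [None] is a
   bottom marker, needed to keep on reading letters [b] with [h b = [::]] when
   the stack of [M] is empty. *)
Definition ih_state : finType := option (dpda_state M * buffer).
Definition ih_stack : finType := option (dpda_stack M).

(* In a final state with an empty buffer, reading takes precedence over the
   silent moves of [M]: these could leave the final state, or diverge, before
   trailing letters [b] with [h b = [::]] are read. *)
Definition ih_must_read (q : dpda_state M) (p : buffer) (Y : ih_stack) : bool :=
  nilp (val p) &&
  (dpda_final q || (if Y is Some Z then ~~ dpda_trans q None Z else true)).

(** Reading [b] only loads the empty buffer with [h b]. Every move of [M], reading or not, becomes a
    silent move, and [ih_must_read] separates the two kinds, whence determinism. *)
Definition ih_trans (s : ih_state) (o : option B) (Y : ih_stack) :
    option (ih_state * seq ih_stack) :=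
  match s, o with
  | None, Some _ => None
  | None, None =>
      Some (Some (dpda_init M, [bseq]), [:: Some (dpda_bottom M); None])
  | Some (q, p), Some b =>
      if ih_must_read q p Y then Some (Some (q, insub_bseq m (h b)), [:: Y])
      else None
  | Some (q, p), None =>
      if ih_must_read q p Y then None else
      if Y is Some Z then
        if dpda_trans q None Z is Some (q', s) then
          Some (Some (q', p), map Some s)
        else if val p is a :: p' then
          if dpda_trans q (Some a) Z is Some (q', s) then
            Some (Some (q', insub_bseq m p'), map Some s)
          else None
        else None
      else None
  end.

Lemma ih_det s Y : ih_trans s None Y <> None ->
  forall b, ih_trans s (Some b) Y = None.
Proof. by case: s => [[q p]|] //=; case: ih_must_read. Qed.

Definition ih_final (s : ih_state) : bool :=
  if s is Some (q, p) then dpda_final q && nilp (val p) else false.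

Definition ih_dpda : dpda B :=
  @Dpda B ih_state ih_stack None None ih_final ih_trans ih_det.

Local Notation steps := (clos_refl_trans _ (@dpda_step A M)).
Local Notation ih_steps := (clos_refl_trans _ (@dpda_step B ih_dpda)).

(** The configurations after the initial move: the marker [None] stays below the stack of [M]. *)
Definition ih_conf (q : dpda_state M) (p : buffer) (v : seq B)
    (t : seq (dpda_stack M)) : dpda_config ih_dpda :=
  (Some (q, p), v, rcons (map Some t) None).

Lemma val_insub_h b : val (insub_bseq m (h b)) = h b.
Proof.
by rewrite insubdK // unfold_in (leq_bigmax (F := fun b => size (h b))).
Qed.

Lemma val_insub_tail (p : buffer) a p' :
  val p = a :: p' -> val (insub_bseq m p' : buffer) = p'.
Proof.
move=> E; apply: insubdK; apply: leq_trans (size_bseq p).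
by rewrite [bseqval _]E /= leqnSn.
Qed.

Lemma dpda_read_not_silent q a Z x :
  dpda_trans (d := M) q (Some a) Z = Some x -> dpda_trans q None Z = None.
Proof.
move=> E; case E0 : (dpda_trans q None Z) => [y|] //.
by rewrite dpda_det ?E0 in E.
Qed.

Lemma ih_step_read q (p : buffer) b v t :
  nilp (val p) ->
  dpda_final q || (if t is Z :: _ then ~~ dpda_trans q None Z else true) ->
  ih_steps (ih_conf q p (b :: v) t) (ih_conf q (insub_bseq m (h b)) v t).
Proof.
move=> Hp Hq; apply: rt_step; rewrite /ih_conf; case: t Hq => [|Z t] Hq /=.
  apply: (@DpdaRead B ih_dpda _ _ _ None [::] _ [:: None]).
  by rewrite /= /ih_must_read Hp Hq.
apply: (@DpdaRead B ih_dpda _ _ _ (Some Z) (rcons (map Some t) None) _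
  [:: Some Z]).
by rewrite /= /ih_must_read Hp Hq.
Qed.

Lemma ih_step_silent q (p : buffer) v Z t q' s :
  ~~ (nilp (val p) && dpda_final q) ->
  dpda_trans q None Z = Some (q', s) ->
  ih_steps (ih_conf q p v (Z :: t)) (ih_conf q' p v (s ++ t)).
Proof.
move=> Hp E; apply: rt_step; rewrite /ih_conf map_cat rcons_cat.
apply: (@DpdaEps B ih_dpda); rewrite /= /ih_must_read E orbF.
by rewrite (negPf Hp).
Qed.

Lemma ih_step_feed q (p : buffer) v Z t q' s a p' :
  val p = a :: p' -> dpda_trans q (Some a) Z = Some (q', s) ->
  ih_steps (ih_conf q p v (Z :: t)) (ih_conf q' (insub_bseq m p') v (s ++ t)).
Proof.
move=> Ep E; apply: rt_step; rewrite /ih_conf map_cat rcons_cat.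
apply: (@DpdaEps B ih_dpda); rewrite /= /ih_must_read Ep /=.
by rewrite (dpda_read_not_silent E) [bseqval p]Ep E.
Qed.

(** The unread input of [M] is [val p ++ hom h v]. Loading the buffer leaves it unchanged, and each
    silent move is one step of [M]. *)
Lemma ih_dpda_sound c c' q p v t :
  ih_steps c c' -> c = ih_conf q p v t ->
  exists q' p' v' t', c' = ih_conf q' p' v' t' /\
    steps (q, val p ++ hom h v, t) (q', val p' ++ hom h v', t').
Proof.
move=> /clos_rt_rt1n_iff Hc.
elim: Hc q p v t => {c c'} [c|c c1 c' Hc _ IH] q p v t E.
  by exists q, p, v, t; split=> //; apply: rt_refl.
suff [q1 [p1 [v1 [t1 [E1 H1]]]]] : exists q1 p1 v1 t1,
    c1 = ih_conf q1 p1 v1 t1 /\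
    steps (q, val p ++ hom h v, t) (q1, val p1 ++ hom h v1, t1).
  have [q' [p' [v' [t' [E' H']]]]] := IH _ _ _ _ E1.
  by exists q', p', v', t'; split=> //; apply: rt_trans H1 H'.
move: E; case: Hc => {c c1 c' IH}.
  move=> s b w Y u s' r Ht [Es Ew Eu]; subst s v.
  move: Ht => /=; case: ifP => // /andP[/nilP Hp _] [<- <-].
  exists q, (insub_bseq m (h b)), w, t; split; first by rewrite /ih_conf -Eu.
  by rewrite Hp val_insub_h; apply: rt_refl.
move=> s w Y u s' r Ht [Es Ew Eu]; subst s w.
move: Ht => /=; case: ifP => // _; case: Y Eu => // Z.
case: t => // Z' t [<- ->]; case E0 : dpda_trans => [[q' s0]|].
  case=> <- <-; exists q', p, v, (s0 ++ t); split.
    by rewrite /ih_conf map_cat rcons_cat.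
  by apply: rt_step; apply: DpdaEps.
case Ep : (bseqval p) => [|a p'] //.
case Ea : dpda_trans => [[q' s0]|] // [<- <-].
exists q', (insub_bseq m p'), v, (s0 ++ t); split.
  by rewrite /ih_conf map_cat rcons_cat.
by rewrite (val_insub_tail Ep) /=; apply: rt_step; apply: DpdaRead.
Qed.

Definition ih_accepts (c : dpda_config ih_dpda) : Prop :=
  exists q t, dpda_final q /\ ih_steps c (ih_conf q [bseq] [::] t).

Lemma ih_accepts_steps c c' : ih_steps c c' -> ih_accepts c' -> ih_accepts c.
Proof.
by move=> H [q [t [Hq Hc]]]; exists q, t; split=> //; apply: rt_trans H Hc.
Qed.

Lemma ih_accepts_final q (p : buffer) t :
  dpda_final q -> nilp (val p) -> ih_accepts (ih_conf q p [::] t).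
Proof.
move=> Hq /nilP Hp; exists q, t; split=> //.
have -> : p = [bseq] by apply: val_inj.
exact: rt_refl.
Qed.

(** Outer induction on the run of [M], inner induction on [v], since several letters may have to be
    loaded before the next move of [M]. *)
Lemma ih_dpda_complete c c' q (p : buffer) v t :
  steps c c' -> dpda_final c'.1.1 -> c'.1.2 = [::] ->
  c = (q, val p ++ hom h v, t) -> ih_accepts (ih_conf q p v t).
Proof.
move=> /clos_rt_rt1n_iff Hc Hf Hn.
elim: Hc q p v t Hf Hn => {c c'} [c|c c1 c' Hc _ IH] q p v t Hf Hn E.
  (* The run of [M] is over with no input left, so the remaining letters have empty images and are
     read in the final state. *)
  rewrite {}E /= in Hf Hn; elim: v p Hn => [|b v IHv] p.
    by rewrite cats0 => /nilP; apply: ih_accepts_final.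
  rewrite hom_cons => E.
  have Hp : nilp (val p) by move: E; rewrite /=; case: (bseqval p).
  apply: (ih_accepts_steps (ih_step_read _ _ Hp _)); first by rewrite Hf.
  by apply: IHv; rewrite val_insub_h -E (nilP Hp).
have {}IH q1 p1 v1 t1 := IH q1 p1 v1 t1 Hf Hn.
elim: v p E => [|b v IHv] p E.
  case: Hc E IH => {c c1}.
    move=> q0 a w Z u q' s Ht [Eq Ew <-] IH; subst q0.
    case Ep : (val p) Ew => [//|a' p'] /= [Ea Ew]; subst a'.
    apply: (ih_accepts_steps (ih_step_feed _ _ Ep Ht)).
    by apply: IH; rewrite (val_insub_tail Ep) Ew.
  move=> q0 w Z u q' s Ht [Eq Ew <-] IH; subst q0.
  (* In a final state with nothing left to read the simulation accepts at once, whatever silent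
     moves [M] still makes. *)
  have [/andP[Hp Hq]|Hpq] := boolP (nilp (val p) && dpda_final q).
    exact: ih_accepts_final.
  apply: (ih_accepts_steps (ih_step_silent _ _ Hpq Ht)).
  by apply: IH; rewrite Ew.
(* Loading [b] leaves the configuration of [M] unchanged, so the inner induction applies to the same
   run. *)
have Hread : nilp (val p) ->
    dpda_final q || (if t is Z :: _ then ~~ dpda_trans q None Z else true) ->
    ih_accepts (ih_conf q p (b :: v) t).
  move=> Hp Hq; apply: (ih_accepts_steps (ih_step_read _ _ Hp Hq)).
  by apply: IHv; rewrite val_insub_h E (nilP Hp).
case: Hc E IH Hread {IHv} => {c c1}.
  move=> q0 a w Z u q' s Ht [Eq Ew <-] IH Hread; subst q0.
  case Ep : (bseqval p) Ew => [|a' p'] /=.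
    by move=> _; apply: Hread; rewrite /= ?Ep // (dpda_read_not_silent Ht) orbT.
  move=> [Ea Ew]; subst a'.
  apply: (ih_accepts_steps (ih_step_feed _ _ Ep Ht)).
  by apply: IH; rewrite (val_insub_tail Ep) Ew.
move=> q0 w Z u q' s Ht [Eq Ew <-] IH Hread; subst q0.
(* In a final state with an empty buffer, [b] is loaded first and the silent move of [M] is
   postponed. *)
have [/andP[Hp Hq]|Hpq] := boolP (nilp (val p) && dpda_final q).
  by apply: Hread; rewrite ?Hq.
apply: (ih_accepts_steps (ih_step_silent _ _ Hpq Ht)).
by apply: IH; rewrite Ew.
Qed.

Lemma ih_dpda_init v :
  ih_steps (None, v, [:: None])
    (ih_conf (dpda_init M) [bseq] v [:: dpda_bottom M]).
Proof. exact: rt_step (@DpdaEps B ih_dpda None v None [::] _ _ erefl). Qed.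

Lemma ih_dpda_start c c' v :
  ih_steps c c' -> c = (None, v, [:: None]) ->
  c' = c \/ ih_steps (ih_conf (dpda_init M) [bseq] v [:: dpda_bottom M]) c'.
Proof.
move=> /clos_rt_rt1n_iff; case=> [|c1 {}c' Hc /clos_rt_rt1n_iff Hc'] E.
  by left.
right; case: Hc E Hc' => {c c1} [s b w Y u s' r Ht|s w Y u s' r Ht].
  by move=> [Es _ _]; rewrite Es in Ht.
by move=> [Es Ew EY Eu]; subst s w Y u; case: Ht => <- <-.
Qed.

Lemma ih_dpdaP : dpda_lang ih_dpda = (hom h @^-1` dpda_lang M)%classic.
Proof.
apply/seteqP; split=> v /=.
  move=> [s [u [Hs /ih_dpda_start/(_ erefl)]]].
  case=> [[E _]|Hc]; first by rewrite E in Hs.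
  have [q [p [v' [t [[Es Ev Eu] Hq]]]]] := ih_dpda_sound Hc erefl.
  subst s v'; move: Hs => /= /andP[Hf /nilP Hp].
  by exists q, t; split=> //; move: Hq; rewrite [val p]Hp.
move=> [q [t [Hf Hc]]].
have [//|q' [t' [Hf' Hc']]] := ih_dpda_complete (p := [bseq]) Hc Hf _ erefl.
exists (Some (q', [bseq])), (rcons (map Some t') None); split.
  by rewrite /= Hf'.
exact: rt_trans (ih_dpda_init v) Hc'.
Qed.

End InverseHomDpda.

Lemma det_context_free_inverse_hom : inverse_hom_closed det_context_free.
Proof. by move=> A B h _ [M ->]; exists (ih_dpda h M); rewrite ih_dpdaP. Qed.

Lemma BDC_inverse_hom : inverse_hom_closed BDC.
Proof.
move=> A B h L.
elim=> {L} [L HL|L1 L2 _ H1 _ H2|L1 L2 _ H1 _ H2|L _ HL].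
- exact/BDC_dcf/det_context_free_inverse_hom.
- exact: BDC_union H1 H2.
- exact: BDC_inter H1 H2.
- exact: BDC_compl HL.
Qed.

(** * Word problems *)

Section WordProblem.
Local Open Scope group_scope.

Definition inv_word (X : finType) (w : seq (letter X)) : seq (letter X) :=
  rev [seq (s.1, ~~ s.2) | s <- w].

Lemma word_val_cat (G : groupType) (X : finType) (f : X -> G) v w :
  word_val f (v ++ w) = word_val f v * word_val f w.
Proof. exact: big_cat. Qed.

Lemma word_val_cons (G : groupType) (X : finType) (f : X -> G) s w :
  word_val f (s :: w) = letter_val f s * word_val f w.
Proof. exact: big_cons. Qed.

Lemma word_val_inv (G : groupType) (X : finType) (f : X -> G) w :
  word_val f (inv_word w) = (word_val f w)^-1.
Proof.
elim: w => [|s w IHw]; first by rewrite /word_val !big_nil invg1.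
rewrite /inv_word /= rev_cons -cats1 word_val_cat IHw.
rewrite [word_val f (_ :: w)]word_val_cons invgM [word_val f [:: _]]big_seq1; congr (_ * _).
by case: s => x [] /=; rewrite /letter_val /= ?invgK.
Qed.

Lemma pres_eq_inv_word (X : finType) (R : set (seq (letter X))) u v w :
  pres_eq R (u ++ inv_word w ++ w ++ v) (u ++ v).
Proof.
elim: w u v => [|[x b] w IHw] u v; first exact: PresRefl.
rewrite /inv_word /= rev_cons -cats1 -!catA /=.
apply: PresTrans (IHw u v); rewrite catA [in X in pres_eq _ _ X]catA.
by have := @PresFree X R (u ++ inv_word w) (w ++ v) x (~~ b); rewrite negbK.
Qed.

(** Taking all words of value 1 as relators presents the group on any generating family: [w1] is
    equivalent to [w1 ++ inv_word w2 ++ w2] by free reduction, and this to [w2] since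
    [w1 ++ inv_word w2] is a relator. *)
Lemma pres_eq_trivial_words (G : groupType) (X : finType) (f : X -> G) w1 w2 :
  word_val f w1 = word_val f w2 <->
  pres_eq [set w | word_val f w = 1]%classic w1 w2.
Proof.
split=> [E|]; last first.
  elim=> {w1 w2} [//|w1 w2 _ -> //|w1 w2 w3 _ -> _ -> //|u v x b|u v r Hr].
    rewrite !word_val_cat; congr (_ * _).
    rewrite !word_val_cons mulgA /letter_val.
    by case: b => /=; rewrite ?mulVg ?mulgV mul1g.
  by rewrite !word_val_cat Hr mul1g.
apply: (@PresTrans _ _ _ (w1 ++ inv_word w2 ++ w2)).
  apply: PresSym.
  by have := @pres_eq_inv_word X [set w | word_val f w = 1]%classic w1 [::] w2;
    rewrite !cats0.
have := @PresRel X [set w | word_val f w = 1]%classic [::] w2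
  (w1 ++ inv_word w2).
rewrite /= -catA; apply.
by rewrite word_val_cat word_val_inv E mulgV.
Qed.

Definition generating_presentation (G : groupType) (X : finType) (f : X -> G)
    (Hf : generates f) : presentation G :=
  Presentation Hf (pres_eq_trivial_words f).

(** Serves both claims: [i] is the identity for a change of presentation and the inclusion for a
    subgroup. *)
Lemma word_problem_pullback (C : language_class) (G H : groupType)
    (i : UMagmaMorphism.type H G) (P : presentation G) (Q : presentation H) :
  inverse_hom_closed C -> injective i ->
  C _ (word_problem P) -> C _ (word_problem Q).
Proof.
move=> HC inj_i.
set f := @pres_val G P; set g := @pres_val H Q.
(* A word over the generators of [P] is chosen for every letter separately, formal inverses
   included. *)
have [h Hh] : {h & forall s, word_val f (h s) = i (letter_val g s)}.
  apply: (@choice _ _ (fun s w => word_val f w = i (letter_val g s))) => s.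
  exact: pres_surj.
have Ehom w : word_val f (hom h w) = i (word_val g w).
  elim: w => [|s w IHw]; first by rewrite /word_val !big_nil gmulf1.
  by rewrite hom_cons word_val_cat IHw Hh word_val_cons gmulfM.
have -> : word_problem Q = (hom h @^-1` word_problem P)%classic.
  apply/seteqP; split=> w; rewrite /word_problem /= Ehom.
    by move=> ->; rewrite gmulf1.
  by move=> E; apply: inj_i; rewrite gmulf1.
exact: HC.
Qed.

End WordProblem.

Theorem theorem3p1 (G : groupType) :
  (forall P Q : presentation G,
     (BDC (word_problem P) <-> BDC (word_problem Q)) /\
     (PCF (word_problem P) <-> PCF (word_problem Q))) /\
  (forall (S : pred G) (H : subGroupType S), finitely_generated H ->
     (has_word_problem_in BDC G -> has_word_problem_in BDC H) /\
     (has_word_problem_in PCF G -> has_word_problem_in PCF H)).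
Proof.
split=> [P Q|S H [X [f Hf]]].
  have tr C (HC : inverse_hom_closed C) (P' Q' : presentation G) :
      C _ (word_problem P') -> C _ (word_problem Q').
    exact: (@word_problem_pullback C G G idfun).
  split; split.
  - exact: (tr _ BDC_inverse_hom).
  - exact: (tr _ BDC_inverse_hom).
  - exact: (tr _ PCF_inverse_hom).
  - exact: (tr _ PCF_inverse_hom).
have tr C (HC : inverse_hom_closed C) :
    has_word_problem_in C G -> has_word_problem_in C H.
  move=> [P HP]; exists (generating_presentation Hf).
  exact: (@word_problem_pullback C G H val) HC val_inj HP.
by split; [exact: (tr _ BDC_inverse_hom)|exact: (tr _ PCF_inverse_hom)].
Qed.
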